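(* Let $r,K,\alpha,\beta>0$, $T>0$, $t_0\in(0,T)$, and $g(t)=t$ for $0\le t\le t_0$, $g(t)=t+\alpha$ for $t_0<t\le T$. Put $R_\beta(x):=\dfrac{x}{1+\beta x}$ for $x\ge0$ and, for $x\ge 0$, $$F(t,x):=\begin{cases} r x\left(1-\dfrac{x}{K}\right),&t\ne t_0,\\[2mm]\dfrac{R_\beta(x)-x}{\alpha},&t=t_0,\end{cases}\qquad \Lambda_s(\xi):=\frac{K\xi e^{rs}}{K+\xi(e^{rs}-1)}\quad(s\ge0,\ \xi\ge0).$$ For $u_0\ge0$, the problem $D_gU=F(t,U)$, $U(0)=u_0$, has a unique nonnegative solution, namely $$U(t)=\begin{cases}\Lambda_t(u_0),&0\le t\le t_0,\\ \Lambda_{t-t_0}(x_+),&t_0<t\le T,\end{cases}\qquad\text{where } x_-:=\Lambda_{t_0}(u_0),\quad x_+:=R_\beta(x_-)=\frac{x_-}{1+\beta x_-}.$$ If $0\le u_0\le K$, then $0\le U(t)\le K$ for all $t\in[0,T]$ and $0\le x_+\le x_-\le K$.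
   Context: The Lebesgue--Stieltjes measure of $g$ on $[0,T)$, characterized by $\mu_g([s,t))=g(t)-g(s)$, is $\mu_g=dt+\alpha\delta_{t_0}$. $AC_g([0,T])$ is the set of $u:[0,T]\to\mathbb R$ such that for every $\varepsilon>0$ there is $\delta>0$ such that, for every finite family of pairwise disjoint intervals $[a_j,b_j)\subset[0,T)$, $\sum_j(g(b_j)-g(a_j))<\delta$ implies $\sum_j|u(b_j)-u(a_j)|<\varepsilon$. Equivalently (known), $u(t)=u(0)+\int_{[0,t)}v\,d\mu_g$ for all $t\in[0,T]$ with some $v\in L^1(\mu_g)$, unique $\mu_g$-a.e. and denoted $D_gu$ (the Stieltjes derivative). A (nonnegative) solution of $D_gU=F(t,U)$, $U(0)=u_0$ is a function $U\in AC_g([0,T])$ with $U\ge0$ and $U(t)=u_0+\int_{[0,t)}F(s,U(s))\,d\mu_g(s)$ for all $t\in[0,T]$. *)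

(* Defs.v *)
From HB Require Import structures.
From mathcomp Require Import all_boot all_order all_algebra.
From mathcomp Require Import all_classical all_reals all_analysis.
Set Implicit Arguments.
Unset Strict Implicit.
Unset Printing Implicit Defensive.
Import Order.TTheory GRing.Theory Num.Theory.
Import numFieldNormedType.Exports.
Local Open Scope classical_set_scope.
Local Open Scope ring_scope.

(* Functions on [0, T] are total functions R -> R of which only the values on
   [0, T] are ever used. *)

Definition derivator {R : realType} (t0 alpha t : R) : R :=
  if t <= t0 then t else t + alpha.

(* The Lebesgue-Stieltjes measure dt + alpha * delta_{t0} of the left-continuous
   function [derivator t0 alpha].  It lives on all of R, but it is used only on
   subsets of [0, T[.  The library's [lebesgue_stieltjes_measure] is not used
   directly because it takes right-continuous functions, with
   mu ]s, t] = g t - g s. *)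
Definition stieltjes_measure {R : realType} (t0 alpha : R)
    (alpha_ge0 : 0 <= alpha) : {measure set (measurableTypeR R) -> \bar R} :=
  measure_add (T := measurableTypeR R) (@lebesgue_measure R)
    (mscale (NngNum alpha_ge0) (@dirac _ (measurableTypeR R) t0 R)).

Lemma stieltjes_measure_itvco {R : realType} (t0 alpha : R)
    (alpha_ge0 : 0 <= alpha) (s t : R) : s <= t ->
  stieltjes_measure t0 alpha_ge0 `[s, t[%classic =
  (derivator t0 alpha t - derivator t0 alpha s)%:E.
Proof.
move=> st; transitivity (lebesgue_measure `[s, t[%classic +
  alpha%:E * \d_t0 `[s, t[%classic)%E.
  exact: measure_addE.
rewrite lebesgue_measure_itv /= lte_fin diracE mem_setE in_itv /= /derivator.
have -> : (if s < t then (t%:E - s%:E)%E else 0%E) = (t - s)%:E :> \bar R.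
  case: ltP => // ts; suff -> : s = t by rewrite subrr.
  by apply/eqP; rewrite eq_le st.
rewrite -EFinM -EFinD; congr EFin.
case: (leP s t0) => st0; case: (leP t t0) => tt0 /=.
- by rewrite mulr0 addr0.
- by rewrite mulr1 addrAC.
- by have := lt_le_trans st0 (le_trans st tt0); rewrite ltxx.
- by rewrite mulr0 addr0 opprD addrACA subrr addr0.
Qed.

Definition g_absolutely_continuous {R : realType} (g : R -> R) (T : R)
    (u : R -> R) : Prop :=
  forall e : R, 0 < e -> exists2 d : R, 0 < d &
    forall (n : nat) (a b : 'I_n -> R),
      (forall j, [/\ 0 <= a j, a j <= b j & b j <= T]) ->
      trivIset [set: 'I_n] (fun j => `[a j, b j[%classic) ->
      \sum_(j < n) (g (b j) - g (a j)) < d ->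
      \sum_(j < n) `|u (b j) - u (a j)| < e.

(* Nonnegative solutions of D_g U = F(t, U), U(0) = u0 on [0, T], where [mu] is
   the Lebesgue-Stieltjes measure of [g].  [Rintegral] is total, so the
   existence of the integrals is stated separately. *)
Definition nonneg_solution {R : realType} (g : R -> R)
    (mu : {measure set (measurableTypeR R) -> \bar R}) (T : R)
    (F : R -> R -> R) (u0 : R) (U : R -> R) : Prop :=
  [/\ g_absolutely_continuous g T U,
      forall t, 0 <= t <= T -> 0 <= U t,
      mu.-integrable `[0, T[%classic (fun s => (F s (U s))%:E) &
      forall t, 0 <= t <= T ->
        U t = u0 + \int[mu]_(s in `[0, t[%classic) F s (U s)].

Definition beverton_holt {R : realType} (beta x : R) : R := x / (1 + beta * x).

Definition logistic_impulse_rhs {R : realType} (r K alpha beta t0 t x : R) : R :=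
  if t == t0 then (beverton_holt beta x - x) / alpha
  else r * x * (1 - x / K).

Definition logistic_flow {R : realType} (r K s xi : R) : R :=
  K * xi * expR (r * s) / (K + xi * (expR (r * s) - 1)).

Definition pre_impulse {R : realType} (r K t0 u0 : R) : R :=
  logistic_flow r K t0 u0.

Definition post_impulse {R : realType} (r K beta t0 u0 : R) : R :=
  beverton_holt beta (pre_impulse r K t0 u0).

Definition logistic_impulse_solution {R : realType} (r K beta t0 u0 t : R) : R :=
  if t <= t0 then logistic_flow r K t u0
  else logistic_flow r K (t - t0) (post_impulse r K beta t0 u0).

(* Main.v *)
(** Off [t0] the measure mu_g is Lebesgue measure, and [t0] is an atom of mass
    alpha; hence [u0 + \int_[0,t[ F(s, U(s)) dmu_g] is an ordinary integral of the
    logistic field on [0, t0], a jump from [U t0] to [beverton_holt beta (U t0)],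
    and again an integral of the logistic field after [t0].  On each of the two
    pieces a solution is therefore continuous, hence C^1 in the interior by the
    fundamental theorem of calculus.  On nonnegative states the logistic field
    satisfies (x - y) (f x - f y) <= r (x - y)^2, so for two solutions y, z the
    function (y - z)^2 exp(- 2 r t) is nonincreasing, which gives uniqueness; the
    explicit flow gives existence. *)
Require Import Defs.
From HB Require Import structures.
From mathcomp Require Import all_boot all_order all_algebra.
From mathcomp Require Import all_classical all_reals all_analysis.
(* Without this, [\bar R] is not recognized as a measurableType here. *)
From mathcomp Require Import measurable_realfun ring.
Set Implicit Arguments.
Unset Strict Implicit.
Unset Printing Implicit Defensive.
Import Order.TTheory GRing.Theory Num.Theory.
Import numFieldNormedType.Exports.
Local Open Scope classical_set_scope.
Local Open Scope ring_scope.

(** * Lebesgue-Stieltjes measures with one atom *)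

Section Measure.
Context {R : realType}.

Lemma integrable_setU d (T : measurableType d)
    (m : {measure set T -> \bar R}) (A B : set T) (f : T -> \bar R) :
  measurable A -> measurable B -> [disjoint A & B] ->
  m.-integrable A f -> m.-integrable B f -> m.-integrable (A `|` B) f.
Proof.
move=> mA mB AB /integrableP[mfA fA] /integrableP[mfB fB].
have mf : measurable_fun (A `|` B) f by apply/measurable_funU.
apply/integrableP; split => //.
rewrite ge0_integral_setU//; last exact: measurableT_comp.
by rewrite lte_add_pinfty.
Qed.

(** Integrability over [D] only sees the measure of subsets of [D]; this exchanges
    [stieltjes_measure] and Lebesgue measure away from the atom. *)
Lemma integrable_eq_measure d (T : measurableType d)
    (m1 m2 : {measure set T -> \bar R}) (D : set T) (f : T -> \bar R) :
  (forall A, measurable A -> A `<=` D -> m1 A = m2 A) ->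
  m1.-integrable D f -> m2.-integrable D f.
Proof.
move=> m12 /integrableP[mf fD]; apply/integrableP; split => //.
by rewrite -(@eq_measure_integral _ _ _ D _ m1).
Qed.

(** The real [c] expresses that the point has finite mass, so that both the atom of mass [alpha] and
    Lebesgue-null points are covered. *)
Lemma integrable_set1 d (T : measurableType d)
    (m : {measure set T -> \bar R}) (x : T) (c : R) (f : T -> R) :
  measurable [set x] -> m [set x] = c%:E ->
  m.-integrable [set x] (EFin \o f).
Proof.
move=> mx mxE; apply: measurable_bounded_integrable => //.
  by rewrite mxE ltry.
  exact: measurable_fun_set1.
by exists `|f x|; split; [exact: normr_real | move=> M /ltW ? _ ->].
Qed.

(** The endpoints have measure zero. The fundamental theorem of calculus is applied on closed
    intervals, while the equation after the impulse only yields integrability on an open one. *)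
Lemma integrable_itvoo_itvcc (a b : R) (f : R -> R) : a < b ->
  lebesgue_measure.-integrable `]a, b[ (EFin \o f) ->
  lebesgue_measure.-integrable `[a, b] (EFin \o f).
Proof.
move=> ab fab; rewrite -(setUitv1 true) ?bnd_simp ?(ltW ab)//.
apply: integrable_setU => //=.
- by apply/disj_setPLR => x /= + xb; rewrite xb in_itv/= ltxx andbF.
- rewrite -(setU1itv false) ?bnd_simp//; apply: integrable_setU => //=.
    by apply/disj_setPLR => x /= ->; rewrite in_itv/= ltxx.
  exact: (integrable_set1 _ _ (lebesgue_measure_set1 a)).
- exact: (integrable_set1 _ _ (lebesgue_measure_set1 b)).
Qed.

Section Stieltjes.
Context (t0 alpha : R) (alpha_ge0 : 0 <= alpha).
Let mu := stieltjes_measure t0 alpha_ge0.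

Lemma stieltjes_measureE (A : set R) :
  mu A = (lebesgue_measure A + alpha%:E * \d_t0 A)%E.
Proof. exact: measure_addE. Qed.

Lemma stieltjes_measure_off (A : set R) : ~ A t0 ->
  mu A = lebesgue_measure A.
Proof.
by move=> At0; rewrite stieltjes_measureE diracE memNset// mule0 adde0.
Qed.

Lemma stieltjes_measure_set1 : mu [set t0] = alpha%:E.
Proof.
rewrite stieltjes_measureE diracE mem_set// mule1.
by rewrite lebesgue_measure_set1 add0e.
Qed.

Lemma integrable_stieltjes_off (D : set R) (f : R -> \bar R) : ~ D t0 ->
  mu.-integrable D f <-> lebesgue_measure.-integrable D f.
Proof.
move=> Dt0; split; apply: integrable_eq_measure => A mA AD.
  by rewrite stieltjes_measure_off// => /AD.
by rewrite stieltjes_measure_off// => /AD.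
Qed.

Lemma Rintegral_stieltjes_off (D : set R) (f : R -> R) : ~ D t0 ->
  \int[mu]_(x in D) f x = \int[lebesgue_measure]_(x in D) f x.
Proof.
move=> Dt0; congr fine; apply: eq_measure_integral => A mA AD.
by rewrite -/mu stieltjes_measure_off// => /AD.
Qed.

Lemma itvco_split (a b : R) : a <= t0 -> t0 < b ->
  `[a, b[%classic =
  `[a, t0[%classic `|` ([set t0] `|` `]t0, b[%classic) :> set R.
Proof.
move=> at0 t0b; rewrite (setU1itv false)?bnd_simp //.
by rewrite -itv_bndbnd_setU// bnd_simp// ltW.
Qed.

Let disj1 (b : R) : [disjoint [set t0] & `]t0, b[%classic].
Proof. by apply/disj_setPLR => x /= ->; rewrite in_itv/= ltxx. Qed.

Let disj2 (a b : R) : [disjoint `[a, t0[%classic & ([set t0] `|` `]t0, b[)].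
Proof.
apply/disj_setPLR => x /=; rewrite !in_itv/= => /andP[_ xt0] [xE|/andP[t0x _]].
  by rewrite xE ltxx in xt0.
by rewrite ltNge (ltW t0x) in xt0.
Qed.

(** The atom has finite mass, so the value [f t0] cannot affect integrability. *)
Lemma integrable_stieltjes (a b : R) (f : R -> R) : a <= t0 -> t0 < b ->
  mu.-integrable `[a, b[ (EFin \o f) <->
  lebesgue_measure.-integrable `[a, t0[ (EFin \o f) /\
  lebesgue_measure.-integrable `]t0, b[ (EFin \o f).
Proof.
move=> at0 t0b; rewrite itvco_split//; split => [fab|[fl fr]].
  split; apply/integrable_stieltjes_off.
  - by rewrite /= in_itv/= ltxx andbF.
  - apply: integrableS fab => //.
    by apply: measurableU => //; exact: measurableU.
  - by rewrite /= in_itv/= ltxx.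
  - apply: integrableS fab => //.
      by apply: measurableU => //; exact: measurableU.
    by move=> x xt; right; right.
apply: integrable_setU => //; [exact: measurableU| |].
  by apply/integrable_stieltjes_off => //=; rewrite in_itv/= ltxx andbF.
apply: integrable_setU => //.
  exact: (integrable_set1 _ _ stieltjes_measure_set1).
by apply/integrable_stieltjes_off => //=; rewrite in_itv/= ltxx.
Qed.

Lemma Rintegral_stieltjes (a b : R) (f : R -> R) : a <= t0 -> t0 < b ->
  mu.-integrable `[a, b[ (EFin \o f) ->
  \int[mu]_(x in `[a, b[) f x =
  \int[lebesgue_measure]_(x in `[a, t0[) f x + (f t0 * alpha +
  \int[lebesgue_measure]_(x in `]t0, b[) f x).
Proof.
move=> at0 t0b; rewrite itvco_split// => fab.
have mr : measurable ([set t0] `|` `]t0, b[%classic) by exact: measurableU.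
rewrite Rintegral_setU// Rintegral_stieltjes_off/=; last first.
  by rewrite in_itv/= ltxx andbF.
congr +%R; rewrite Rintegral_setU//; last first.
  by apply: integrableS fab => //; exact: measurableU.
congr +%R; last by rewrite Rintegral_stieltjes_off//= in_itv/= ltxx.
rewrite (@eq_Rintegral _ _ _ _ _ (cst (f t0))).
  by rewrite Rintegral_cst//= stieltjes_measure_set1.
by move=> x /[!inE] ->.
Qed.

End Stieltjes.
End Measure.

(** * Autonomous scalar equations *)

Section ODE.
Context {R : realType}.

(** A Gronwall argument. The one-sided bound is required only along the two trajectories, so it can
    exploit their nonnegativity. *)
Lemma one_sided_lipschitz_unique (f : R -> R) (L a b : R) (y z : R -> R) :
  {within `[a, b], continuous y} -> {within `[a, b], continuous z} ->
  (forall t, t \in `]a, b[ -> is_derive t 1 y (f (y t))) ->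
  (forall t, t \in `]a, b[ -> is_derive t 1 z (f (z t))) ->
  (forall t, t \in `]a, b[ ->
    (y t - z t) * (f (y t) - f (z t)) <= L * (y t - z t) ^+ 2) ->
  y a = z a -> forall t, t \in `[a, b] -> y t = z t.
Proof.
move=> cy cz dy dz fL yza t tab.
(* The weight is chosen so that its derivative contributes the term [- L * (y s - z s) ^+ 2], which
   makes the derivative of [h] nonpositive by the one-sided bound. *)
pose h s := (y s - z s) ^+ 2 * expR (- (2 * L) * s).
have dh s : s \in `]a, b[ -> is_derive s 1 h
    (2 * expR (- (2 * L) * s) *
     ((y s - z s) * (f (y s) - f (z s)) - L * (y s - z s) ^+ 2)).
  move=> sab; have := dy s sab; have := dz s sab => dzs dys.
  have := is_derive1_comp (is_derive_expR (- (2 * L) * s))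
    (is_deriveZ (- (2 * L)) (is_derive_id s 1)).
  move=> /(is_deriveM (is_deriveX 2 (is_deriveB dys dzs))).
  move=> /is_derive_eq; apply.
  rewrite !fctE /GRing.scale/= expr1; ring.
have ch : {within `[a, b], continuous h}.
  have cd : {within `[a, b], continuous (fun s => y s - z s)}.
    by move=> x; apply: cvgB; [exact: cy|exact: cz].
  have ce : {within `[a, b], continuous (fun s => expR (- (2 * L) * s))}.
    apply: continuous_subspaceT => s; apply: continuous_comp.
      exact: mulrl_continuous.
    exact: continuous_expR.
  by move=> x; apply: cvgM; [apply: cvgM; exact: cd|exact: ce].
have ab : a <= b by move: tab; rewrite in_itv/= => /andP[]; exact: le_trans.
have aab : a \in `[a, b] by rewrite in_itv/= lexx.
have : h t <= h a.
  apply: (@ler0_derive1_le_cc _ h a b) => //; last by rewrite (itvP tab).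
    by move=> x /dh[].
  move=> x xab; rewrite derive1E (@derive_val _ _ _ _ _ _ _ (dh x xab)).
  by rewrite pmulr_rle0 ?mulr_gt0 ?expR_gt0// subr_le0 fL.
(* Here [h a = 0], so the square at [t] is at most zero and hence vanishes. *)
rewrite /h yza subrr expr0n mul0r pmulr_lle0 ?expR_gt0// => yzt.
by apply/eqP; rewrite -subr_eq0 -sqrf_eq0 eq_le yzt sqr_ge0.
Qed.

(** A bootstrap: an indefinite integral is continuous, so [y] is continuous; then the integrand
    [f \o y] is continuous, and the fundamental theorem of calculus differentiates [y]. *)
Lemma integral_solution_C1 (f y : R -> R) (a b : R) : a < b ->
  continuous f ->
  lebesgue_measure.-integrable `]a, b[ (EFin \o (f \o y)) ->
  (forall t, t \in `[a, b] ->
    y t = y a + \int[lebesgue_measure]_(s in `[a, t[) f (y s)) ->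
  {within `[a, b], continuous y} /\
  forall t, t \in `]a, b[ -> is_derive t 1 y (f (y t)).
Proof.
move=> ab cf /(integrable_itvoo_itvcc ab) iy yE.
(* [G t] integrates over the closed interval from [a] to [t]; the added endpoint is null. *)
pose G t := parameterized_integral lebesgue_measure a t (f \o y).
have {}yE t : t \in `[a, b] -> y t = y a + G t.
  move=> tab; rewrite {1}yE// Rintegral_itv_bndo_bndc//.
  apply: integrableS iy => // x /=; rewrite !in_itv/= => /andP[->/= /ltW xt].
  by rewrite (le_trans xt)// (itvP tab).
have cG : {within `[a, b], continuous G}.
  exact: parameterized_integral_continuous (ltW ab) iy.
have cy : {within `[a, b], continuous y}.
  apply: (@subspace_eq_continuous _ _ _ (fun t => y a + G t)).
    by move=> t /[!inE] tab; rewrite -yE.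
  by move=> x; apply: cvgD; [exact: cvg_cst|exact: cG].
split=> // t tab.
have yt : {for t, continuous (f \o y)}.
  apply: continuous_comp; last exact: cf.
  by move/(continuous_within_itvP _ ab) : cy => [+ _ _]; exact.
have /andP[at_ tb] : a < t < b by rewrite in_itv/= in tab.
have [dG GE] := continuous_FTC1_closed tb iy at_ yt.
have : is_derive t 1 G (f (y t)).
  by apply: DeriveDef; [exact: dG|rewrite -derive1E GE].
move=> /(is_deriveD (is_derive_cst (y a) t 1)); rewrite add0r.
(* The identity [y = y a + G] holds on [[a, b]] only, which contains a neighbourhood of the interior
   point [t]. *)
apply: near_eq_is_derive; near=> x.
rewrite fctE [RHS]yE//; apply: subset_itv_oo_cc.
by near: x; exact: near_in_itvoo.
Unshelve. all: by end_near. Qed.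

End ODE.

(** * The logistic flow *)

Definition logistic_rhs {R : realType} (r K x : R) : R := r * x * (1 - x / K).

Section LogisticFlow.
Context {R : realType} (r K : R) (r_gt0 : 0 < r) (K_gt0 : 0 < K).

Lemma continuous_logistic_rhs : continuous (logistic_rhs r K).
Proof.
move=> x; apply: cvgM; first exact: mulrl_continuous.
by apply: cvgB; [exact: cvg_cst|exact: mulrr_continuous].
Qed.

(** The gap between the two sides is exactly [r * (x - y) ^+ 2 * ((x + y) / K)]. This is where
    nonnegativity of solutions enters the uniqueness proof. *)
Lemma logistic_rhs_one_sided_lipschitz (x y : R) : 0 <= x -> 0 <= y ->
  (x - y) * (logistic_rhs r K x - logistic_rhs r K y) <= r * (x - y) ^+ 2.
Proof.
move=> x0 y0; rewrite -subr_ge0.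
have -> : r * (x - y) ^+ 2 -
    (x - y) * (logistic_rhs r K x - logistic_rhs r K y) =
    r * (x - y) ^+ 2 * ((x + y) / K).
  by rewrite /logistic_rhs; ring.
have [r0 K0] := (ltW r_gt0, ltW K_gt0).
apply: mulr_ge0; [apply: mulr_ge0 => //; exact: sqr_ge0|].
by apply: divr_ge0 => //; exact: addr_ge0.
Qed.

Lemma logistic_flow0 (xi : R) : logistic_flow r K 0 xi = xi.
Proof.
rewrite /logistic_flow mulr0 expR0 mulr1 subrr mulr0 addr0 mulrC.
by rewrite mulKf// gt_eqF.
Qed.

Section NonnegativeTime.
Context (s xi : R) (s_ge0 : 0 <= s) (xi_ge0 : 0 <= xi).

Let exp_ge1 : 1 <= expR (r * s).
Proof. by rewrite -expR0 ler_expR mulr_ge0// ltW. Qed.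

Lemma logistic_flow_denom_gt0 : 0 < K + xi * (expR (r * s) - 1).
Proof. by rewrite ltr_pwDl// mulr_ge0// subr_ge0. Qed.

Lemma logistic_flow_ge0 : 0 <= logistic_flow r K s xi.
Proof.
apply: divr_ge0; last exact: ltW logistic_flow_denom_gt0.
by rewrite !mulr_ge0 ?expR_ge0// ltW.
Qed.

(** A crude bound, uniform in time and valid also for [xi > K]; it bounds the logistic field along
    the flow. *)
Lemma logistic_flow_leD : logistic_flow r K s xi <= K + xi.
Proof.
rewrite /logistic_flow ler_pdivrMr ?logistic_flow_denom_gt0// -subr_ge0.
have := exp_ge1; set e := expR _ => e1.
have -> : (K + xi) * (K + xi * (e - 1)) - K * xi * e =
  K ^+ 2 + xi ^+ 2 * (e - 1) by ring.
by rewrite addr_ge0 ?sqr_ge0// mulr_ge0 ?sqr_ge0 ?subr_ge0.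
Qed.

Lemma logistic_flow_leK : xi <= K -> logistic_flow r K s xi <= K.
Proof.
move=> xiK; rewrite /logistic_flow.
rewrite ler_pdivrMr ?logistic_flow_denom_gt0// -subr_ge0.
have := exp_ge1; set e := expR _ => e1.
have -> : K * (K + xi * (e - 1)) - K * xi * e = K * (K - xi) by ring.
by rewrite mulr_ge0 ?subr_ge0// ltW.
Qed.

Lemma is_derive_logistic_flow : is_derive s 1 ((logistic_flow r K)^~ xi)
  (logistic_rhs r K (logistic_flow r K s xi)).
Proof.
have D0 := lt0r_neq0 logistic_flow_denom_gt0.
have de : is_derive s 1 (fun t => expR (r * t)) (expR (r * s) * r).
  have := is_derive1_comp (is_derive_expR (r * s))
    (is_deriveZ r (is_derive_id s 1)).
  by move=> /is_derive_eq; apply; rewrite /GRing.scale/= mulr1.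
have dD : is_derive s 1 (fun t => K + xi * (expR (r * t) - 1))
    (xi * (expR (r * s) * r)).
  have := is_deriveD (is_derive_cst K s 1)
    (is_deriveZ xi (is_deriveB de (is_derive_cst (1 : R) s 1))).
  by move=> /is_derive_eq; apply; rewrite /GRing.scale/= add0r subr0.
have := is_deriveM (is_deriveZ (K * xi) de) 
  (@is_deriveV _ (fun t => K + xi * (expR (r * t) - 1)) _ _ _ D0 dD).
move=> /is_derive_eq; apply; rewrite /GRing.scale/= /logistic_rhs /logistic_flow.
(* Scaling is turned into multiplication so that [field] applies; its side conditions are that the
   denominator of the flow and [K] are nonzero. *)
set e := expR _; rewrite -[_ *: e]/(_ * e).
by field; rewrite D0 gt_eqF.
Qed.

End NonnegativeTime.

(** The flow started at time [a], so that one statement serves both pieces, with [a = 0] and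
    [a = t0]. *)
Lemma is_derive_logistic_flow_shift (xi a s : R) : 0 <= xi -> a <= s ->
  is_derive s 1 (fun s => logistic_flow r K (s - a) xi)
    (logistic_rhs r K (logistic_flow r K (s - a) xi)).
Proof.
move=> xi0; rewrite -subr_ge0 => sa.
have := @is_derive1_comp R ((logistic_flow r K)^~ xi) (shift (- a)) s _ _
  (is_derive_logistic_flow sa xi0) (is_derive_shift s 1 (- a)).
by rewrite mulr1.
Qed.

Lemma continuous_logistic_flow (xi a b : R) : 0 <= xi ->
  {within `[a, b], continuous (fun s => logistic_flow r K (s - a) xi)}.
Proof.
move=> xi0; apply: derivable_within_continuous => s.
rewrite in_itv/= => /andP[as_ _].
by have [] := is_derive_logistic_flow_shift xi0 as_.
Qed.

Lemma continuous_logistic_rhs_flow (xi a b : R) : 0 <= xi ->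
  {within `[a, b], continuous
    (fun s => logistic_rhs r K (logistic_flow r K (s - a) xi))}.
Proof.
move=> xi0 x; apply: (@continuous_comp _ _ _
  (fun s : subspace `[a, b] => logistic_flow r K (s - a) xi)).
  exact: (@continuous_logistic_flow xi a b xi0 x).
exact: continuous_logistic_rhs.
Qed.

Lemma integrable_logistic_flow (xi a b : R) : 0 <= xi ->
  lebesgue_measure.-integrable `[a, b]
    (fun s => (logistic_rhs r K (logistic_flow r K (s - a) xi))%:E).
Proof.
move=> xi0; apply: continuous_compact_integrable; first exact: segment_compact.
exact: continuous_logistic_rhs_flow.
Qed.

Lemma Rintegral_logistic_flow (xi a b : R) : 0 <= xi -> a <= b ->
  \int[lebesgue_measure]_(s in `[a, b])
    logistic_rhs r K (logistic_flow r K (s - a) xi) =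
  logistic_flow r K (b - a) xi - xi.
Proof.
(* The degenerate interval is treated apart, since the fundamental theorem of calculus is applied
   with [a < b]. *)
move=> xi0; rewrite le_eqVlt => /predU1P[<-|ab].
  by rewrite set_itv1 Rintegral_set1 subrr logistic_flow0 subrr.
have cL := @continuous_logistic_flow xi a b xi0.
rewrite /Rintegral (@continuous_FTC2 _ _
  (fun s => logistic_flow r K (s - a) xi)) ?subrr ?logistic_flow0//.
- exact: continuous_logistic_rhs_flow.
- have [_ ca cb] := (continuous_within_itvP _ ab).1 cL.
  split; [move=> s|exact: ca|exact: cb].
  rewrite in_itv/= => /andP[/ltW as_ _].
  by have [] := is_derive_logistic_flow_shift xi0 as_.
- move=> s; rewrite in_itv/= => /andP[/ltW as_ _].
  rewrite derive1E.
  by have [_ ->] := is_derive_logistic_flow_shift xi0 as_.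
Qed.

(** By the mean value theorem, a bound on the field along the flow suffices. *)
Lemma logistic_flow_lipschitz (xi : R) : 0 <= xi ->
  exists2 M, 0 <= M & forall s t, 0 <= s -> s <= t ->
    `|logistic_flow r K t xi - logistic_flow r K s xi| <= M * (t - s).
Proof.
move=> xi0; have Kxi0 : 0 <= K + xi by rewrite addr_ge0// ltW.
(* Obtained from [r * L * (1 - L / K)] by the triangle inequality and [0 <= L <= K + xi]. *)
exists (r * (K + xi) * (1 + (K + xi) / K)).
  by rewrite !mulr_ge0// ?addr_ge0// ?divr_ge0// ltW.
move=> s t s0 st.
have [||c cst ->] := @MVT_segment R ((logistic_flow r K)^~ xi)
    (fun s => logistic_rhs r K (logistic_flow r K s xi)) s t st.
- move=> x; rewrite in_itv/= => /andP[/ltW sx _].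
  exact: is_derive_logistic_flow (le_trans s0 sx) xi0.
- apply: derivable_within_continuous => x; rewrite in_itv/= => /andP[sx _].
  by have [] := is_derive_logistic_flow (le_trans s0 sx) xi0.
have c0 : 0 <= c by rewrite (le_trans s0)// (itvP cst).
have L0 := logistic_flow_ge0 c0 xi0; have LK := logistic_flow_leD c0 xi0.
rewrite normrM (ger0_norm (_ : 0 <= t - s)) ?subr_ge0//.
rewrite ler_wpM2r ?subr_ge0// /logistic_rhs.
move: (logistic_flow r K c xi) L0 LK => L L0 LK.
rewrite !normrM (gtr0_norm r_gt0) (ger0_norm L0) ler_pM ?mulr_ge0 ?(ltW r_gt0)//.
  by rewrite ler_wpM2l// ltW.
rewrite (le_trans (ler_normB _ _))// normr1 lerD2l ger0_norm.
  by rewrite ler_wpM2r ?invr_ge0// ltW.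
by rewrite divr_ge0// ltW.
Qed.

End LogisticFlow.

(** * The impulsive logistic equation *)

Lemma lipschitz_g_absolutely_continuous {R : realType} (g u : R -> R)
    (T L : R) : 0 <= L ->
  (forall a b, 0 <= a -> a <= b -> b <= T ->
    `|u b - u a| <= L * (g b - g a)) ->
  g_absolutely_continuous g T u.
Proof.
move=> L0 uL e e0; have L1 : 0 < L + 1 by rewrite ltr_wpDl.
(* Dividing by [L + 1] rather than [L] covers [L = 0] and leaves a strict inequality at the end. *)
exists (e / (L + 1)) => [|n a b ab _ gd]; first by rewrite divr_gt0.
apply: (@le_lt_trans _ _ (L * \sum_(j < n) (g (b j) - g (a j)))).
  by rewrite mulr_sumr; apply: ler_sum => j _; have [? ? ?] := ab j; exact: uL.
rewrite (@le_lt_trans _ _ (L * (e / (L + 1))))//.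
  by rewrite ler_wpM2l// ltW.
by rewrite mulrCA gtr_pMr// ltr_pdivrMr// mul1r ltrDl.
Qed.

Lemma beverton_holt_ge0 {R : realType} (beta x : R) :
  0 <= beta -> 0 <= x -> 0 <= beverton_holt beta x.
Proof. by move=> b0 x0; rewrite divr_ge0// addr_ge0// mulr_ge0. Qed.

Lemma beverton_holt_le {R : realType} (beta x : R) :
  0 <= beta -> 0 <= x -> beverton_holt beta x <= x.
Proof.
move=> b0 x0; have bx0 : 0 <= beta * x by rewrite mulr_ge0.
rewrite /beverton_holt ler_pdivrMr ?ltr_wpDr//.
by rewrite ler_peMr// lerDl.
Qed.

Section ImpulsiveLogistic.
Context {R : realType} (r K alpha beta T t0 : R).
Context (r_gt0 : 0 < r) (K_gt0 : 0 < K) (alpha_gt0 : 0 < alpha)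
  (beta_gt0 : 0 < beta) (t0_gt0 : 0 < t0) (t0_ltT : t0 < T).
Let f := logistic_rhs r K.
Let F := logistic_impulse_rhs r K alpha beta t0.
Let mu := stieltjes_measure t0 (ltW alpha_gt0).
Let leb := @lebesgue_measure R.

(** * Reduction to Lebesgue integrals on either side of the impulse *)

Let FE s x : s != t0 -> F s x = f x.
Proof. by rewrite /F /logistic_impulse_rhs => /negPf ->. Qed.

Let in_co s b : b <= t0 -> s \in `[0, b[%classic -> s != t0.
Proof.
move=> bt0; rewrite inE/= in_itv/= => /andP[_ sb].
by rewrite lt_eqF// (lt_le_trans sb).
Qed.

Let in_oo s b : s \in `]t0, b[%classic -> s != t0.
Proof. by rewrite inE/= in_itv/= => /andP[ts _]; rewrite gt_eqF. Qed.

Lemma integrable_logistic_impulse (V : R -> R) :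
  mu.-integrable `[0, T[ (fun s => (F s (V s))%:E) <->
  leb.-integrable `[0, t0[ (fun s => (f (V s))%:E) /\
  leb.-integrable `]t0, T[ (fun s => (f (V s))%:E).
Proof.
rewrite (@integrable_stieltjes _ _ _ _ 0 T (fun s => F s (V s)))//;
  last exact: ltW.
split=> -[h1 h2]; split.
- by apply: eq_integrable h1 => // s st; rewrite /= FE// (in_co _ st).
- by apply: eq_integrable h2 => // s st; rewrite /= FE// (in_oo st).
- by apply: eq_integrable h1 => // s st; rewrite /= FE// (in_co _ st).
- by apply: eq_integrable h2 => // s st; rewrite /= FE// (in_oo st).
Qed.

(** The interval [[0, t[] misses the atom even for [t = t0]: the value at [t0] is the one before the
    jump. *)
Lemma Rintegral_logistic_impulse_before (V : R -> R) (t : R) : t <= t0 ->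
  \int[mu]_(s in `[0, t[) F s (V s) = \int[leb]_(s in `[0, t[) f (V s).
Proof.
move=> tt0; rewrite Rintegral_stieltjes_off.
  by apply: eq_Rintegral => s st; rewrite FE// (in_co tt0 st).
by rewrite /= in_itv/= => /andP[_]; rewrite ltNge tt0.
Qed.

Lemma Rintegral_logistic_impulse_after (V : R -> R) (t : R) :
  t0 < t -> t <= T -> mu.-integrable `[0, T[ (fun s => (F s (V s))%:E) ->
  \int[mu]_(s in `[0, t[) F s (V s) =
  \int[leb]_(s in `[0, t0[) f (V s) + (beverton_holt beta (V t0) - V t0 +
  \int[leb]_(s in `]t0, t[) f (V s)).
Proof.
move=> t0t tT iF; rewrite (Rintegral_stieltjes (f := fun s => F s (V s)))//.
(* The mass [alpha] of the atom cancels the division by [alpha] in the impulse. *)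
- rewrite {2}/F /logistic_impulse_rhs eqxx divfK ?gt_eqF//.
  congr (_ + (_ + _)); apply: eq_Rintegral => s st; rewrite FE//.
    by rewrite (in_co _ st).
  by rewrite (in_oo st).
- exact: ltW.
- apply: integrableS iF => // s /=; rewrite !in_itv/= => /andP[->/= st].
  exact: lt_le_trans tT.
Qed.

(** * Existence and bounds for the explicit solution *)

Section Solution.
Context (u0 : R) (u0_ge0 : 0 <= u0).
Let U := logistic_impulse_solution r K beta t0 u0.
Let xm := pre_impulse r K t0 u0.
Let xp := post_impulse r K beta t0 u0.

Lemma pre_impulse_ge0 : 0 <= xm.
Proof. by apply: logistic_flow_ge0 => //; exact: ltW. Qed.

Lemma post_impulse_ge0 : 0 <= xp.
Proof. by apply: beverton_holt_ge0; [exact: ltW|exact: pre_impulse_ge0]. Qed.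

(** Written with [t - 0] to match the shifted flow lemmas at [a = 0]. *)
Lemma solution_before t : t <= t0 -> U t = logistic_flow r K (t - 0) u0.
Proof. by rewrite /U /logistic_impulse_solution subr0 => ->. Qed.

Lemma solution_after t : t0 < t -> U t = logistic_flow r K (t - t0) xp.
Proof. by rewrite /U /logistic_impulse_solution leNgt => ->. Qed.

Lemma solution_ge0 t : 0 <= t -> 0 <= U t.
Proof.
move=> t_ge0; case: (leP t t0) => [tt0|t0t].
  by rewrite solution_before// subr0 logistic_flow_ge0.
rewrite solution_after// logistic_flow_ge0 ?post_impulse_ge0//.
by rewrite subr_ge0 ltW.
Qed.

(** The flow keeps nonnegative states below [K], and the impulse does not increase them. *)
Lemma solution_leK t : 0 <= t -> u0 <= K -> U t <= K.
Proof.
move=> t_ge0 u0K; case: (leP t t0) => [tt0|t0t].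
  by rewrite solution_before// subr0 logistic_flow_leK.
rewrite solution_after// logistic_flow_leK ?post_impulse_ge0//.
  by rewrite subr_ge0 ltW.
rewrite (le_trans (beverton_holt_le (ltW beta_gt0) pre_impulse_ge0))//.
by rewrite logistic_flow_leK// ltW.
Qed.

(** Increments of [U] are bounded by a constant times those of [derivator t0 alpha], whose jump
    [alpha] pays for the jump of [U]. *)
Lemma solution_g_absolutely_continuous :
  g_absolutely_continuous (derivator t0 alpha) T U.
Proof.
have [M1 M10 LM1] := logistic_flow_lipschitz r_gt0 K_gt0 u0_ge0.
have [M2 M20 LM2] := logistic_flow_lipschitz r_gt0 K_gt0 post_impulse_ge0.
(* The jump of [U] per unit of mass of the atom. *)
pose J := `|xp - xm| / alpha.
have J0 : 0 <= J by rewrite divr_ge0// ltW.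
apply: (@lipschitz_g_absolutely_continuous _ _ _ _ (M1 + M2 + J)).
  by rewrite !addr_ge0.
move=> a b a0 ab bT; rewrite /derivator.
case: (leP a t0) => at0; case: (leP b t0) => bt0.
- rewrite !solution_before// !subr0 (le_trans (LM1 _ _ a0 ab))//.
  by rewrite ler_wpM2r ?subr_ge0// -addrA lerDl addr_ge0.
(* The interval straddles the impulse, so the increment is split at [xm] and [xp] into flow, jump
   and flow. *)
- rewrite solution_after// solution_before// subr0.
  have h2 := LM2 0 (b - t0) (lexx _); rewrite logistic_flow0// subr0 in h2.
  have {}h2 : `|logistic_flow r K (b - t0) xp - xp| <= M2 * (b - t0).
    by apply: h2; rewrite subr_ge0 ltW.
  have h1 := LM1 a t0 a0 at0; rewrite -/(pre_impulse r K t0 u0) -/xm in h1.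
  have hJ : `|xp - xm| = J * alpha by rewrite divfK// gt_eqF.
  have -> : logistic_flow r K (b - t0) xp - logistic_flow r K a u0 =
    (logistic_flow r K (b - t0) xp - xp) + (xp - xm) +
    (xm - logistic_flow r K a u0) by ring.
  rewrite (le_trans (ler_normD _ _))// (le_trans (lerD (ler_normD _ _) h1))//.
  rewrite hJ (le_trans (lerD (lerD h2 (lexx _)) (lexx _)))//.
  rewrite -subr_ge0.
  have -> : (M1 + M2 + J) * (b + alpha - a) -
      (M2 * (b - t0) + J * alpha + M1 * (t0 - a)) =
      M1 * (b - t0 + alpha) + M2 * (t0 - a + alpha) + J * (b - a) by ring.
  have [al0 bt0' ba] : [/\ 0 <= alpha, 0 <= b - t0 & 0 <= b - a].
    by rewrite !subr_ge0 ab !ltW.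
  by rewrite !addr_ge0// mulr_ge0// addr_ge0// subr_ge0.
- by have := lt_le_trans at0 (le_trans ab bt0); rewrite ltxx.
- rewrite !solution_after//.
  have h2 := LM2 (a - t0) (b - t0).
  rewrite subr_ge0 (ltW at0) lerD2r ab in h2.
  rewrite (le_trans (h2 _ _))//.
  have -> : b - t0 - (a - t0) = b + alpha - (a + alpha) by ring.
  rewrite ler_wpM2r//; first by rewrite subr_ge0 lerD2r.
  by rewrite addrAC lerDr addr_ge0.
Qed.

Lemma solution_integrable : mu.-integrable `[0, T[ (fun s => (F s (U s))%:E).
Proof.
apply/integrable_logistic_impulse; split.
  have iL : leb.-integrable `[0, t0[
      (fun s => (f (logistic_flow r K (s - 0) u0))%:E).
    apply: integrableS (integrable_logistic_flow r_gt0 K_gt0 0 t0 u0_ge0) => //.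
    exact: subset_itv_co_cc.
  apply: eq_integrable iL => // s; rewrite inE/= in_itv/= => /andP[_ /ltW st].
  by rewrite solution_before.
have iL : leb.-integrable `]t0, T[
    (fun s => (f (logistic_flow r K (s - t0) xp))%:E).
  apply: integrableS
    (integrable_logistic_flow r_gt0 K_gt0 t0 T post_impulse_ge0) => //.
  exact: subset_itv_oo_cc.
apply: eq_integrable iL => // s; rewrite inE/= in_itv/= => /andP[ts _].
by rewrite solution_after.
Qed.

Lemma solution_integral_before t : 0 <= t -> t <= t0 ->
  \int[leb]_(s in `[0, t[) f (U s) = U t - u0.
Proof.
move=> t_ge0 tt0; rewrite [in RHS]solution_before// -Rintegral_logistic_flow//.
rewrite -Rintegral_itv_bndo_bndc; last first.
  apply: integrableS (integrable_logistic_flow r_gt0 K_gt0 0 t u0_ge0) => //.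
  exact: subset_itv_co_cc.
apply: eq_Rintegral => s; rewrite inE/= in_itv/= => /andP[_ st].
by rewrite solution_before// ltW// (lt_le_trans st).
Qed.

(** The flow restarts from [xp], the right limit of [U] at [t0], and not from [U t0 = xm]. *)
Lemma solution_integral_after t : t0 < t ->
  \int[leb]_(s in `]t0, t[) f (U s) = U t - xp.
Proof.
move=> t0t; rewrite [in RHS]solution_after// -Rintegral_logistic_flow//.
- have iL := @integrable_logistic_flow _ r K r_gt0 K_gt0 xp t0 t post_impulse_ge0.
  rewrite -Rintegral_itv_bndo_bndc; last first.
    by apply: integrableS iL => //; exact: subset_itv_co_cc.
  rewrite -Rintegral_itv_obnd_cbnd; last first.
    by apply: integrableS iL => //; exact: subset_itv_oo_cc.
  apply: eq_Rintegral => s; rewrite inE/= in_itv/= => /andP[ts _].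
  by rewrite solution_after.
- exact: post_impulse_ge0.
- exact: ltW.
Qed.

Lemma nonneg_solution_logistic_impulse :
  nonneg_solution (derivator t0 alpha) mu T F u0 U.
Proof.
split.
- exact: solution_g_absolutely_continuous.
- by move=> t /andP[t_ge0 _]; exact: solution_ge0.
- exact: solution_integrable.
move=> t /andP[t_ge0 tT]; case: (leP t t0) => [tt0|t0t].
  rewrite Rintegral_logistic_impulse_before//.
  by rewrite solution_integral_before// subrKC.
rewrite Rintegral_logistic_impulse_after//; last exact: solution_integrable.
rewrite solution_integral_before// ?solution_integral_after//; last exact: ltW.
(* The three contributions [xm - u0], [xp - xm] and [U t - xp] telescope. *)
rewrite (solution_before (lexx t0)) subr0 -/xm -/xp.
by rewrite -/(pre_impulse _ _ _ _) -/xm -/(post_impulse _ _ _ _ _) -/xp; ring.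
Qed.

(** * Uniqueness, first up to the impulse and then after it *)

Section Uniqueness.
Context (V : R -> R)
  (V_sol : nonneg_solution (derivator t0 alpha) mu T F u0 V).

Let V_ge0 t : 0 <= t -> t <= T -> 0 <= V t.
Proof. by case: V_sol => _ + _ _ t_ge0 tT; apply; rewrite t_ge0. Qed.

Let V_int : mu.-integrable `[0, T[ (fun s => (F s (V s))%:E).
Proof. by case: V_sol. Qed.

Let V_before t : 0 <= t -> t <= t0 ->
  V t = u0 + \int[leb]_(s in `[0, t[) f (V s).
Proof.
move=> t_ge0 tt0; case: V_sol => _ _ _ ->; last first.
  by rewrite t_ge0 (le_trans tt0)// ltW.
by rewrite Rintegral_logistic_impulse_before.
Qed.

(** The initial value and the integral over [[0, t0[] add up to [V t0], which cancels against the
    jump term. *)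
Let V_after t : t0 < t -> t <= T ->
  V t = beverton_holt beta (V t0) + \int[leb]_(s in `]t0, t[) f (V s).
Proof.
move=> t0t tT; case: V_sol => _ _ _ ->; last first.
  by rewrite tT (le_trans _ (ltW t0t))// ltW.
rewrite Rintegral_logistic_impulse_after// addrA -V_before ?(ltW t0_gt0)//.
by ring.
Qed.

Lemma logistic_impulse_unique_before t : 0 <= t -> t <= t0 -> V t = U t.
Proof.
move=> t_ge0 tt0; rewrite solution_before//.
have V0 : V 0 = u0.
  rewrite V_before ?(ltW t0_gt0)// set_itv_ge ?bnd_simp//.
  by rewrite Rintegral_set0 addr0.
have [iV _] := (integrable_logistic_impulse V).1 V_int.
have [|||cV dV] := @integral_solution_C1 R f V 0 t0 t0_gt0.
- exact: continuous_logistic_rhs.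
- by apply: integrableS iV => //; exact: subset_itv_oo_co.
- move=> s; rewrite in_itv/= => /andP[s0 st]; rewrite V0.
  exact: V_before.
apply: (@one_sided_lipschitz_unique _ f r 0 t0 V
  (fun s => logistic_flow r K (s - 0) u0) cV _ dV).
- exact: continuous_logistic_flow.
- move=> s; rewrite in_itv/= => /andP[/ltW s0 _].
  exact: is_derive_logistic_flow_shift.
- move=> s; rewrite in_itv/= => /andP[/ltW s0 /ltW st].
  apply: logistic_rhs_one_sided_lipschitz => //.
    by rewrite V_ge0// (le_trans st)// ltW.
  by rewrite logistic_flow_ge0// subr0.
- by rewrite subr0 logistic_flow0.
- by rewrite in_itv/= t_ge0.
Qed.

Lemma logistic_impulse_unique_after t : t0 < t -> t <= T -> V t = U t.
Proof.
move=> t0t tT; rewrite solution_after//.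
(* [V t0] is the value before the jump, so [V] need not be right-continuous at [t0]; [W] puts the
   value after the jump there and is continuous on [[t0, T]]. *)
pose W s := if s <= t0 then xp else V s.
have WE s : t0 < s -> W s = V s by rewrite /W leNgt => ->.
have Wt0 : W t0 = xp by rewrite /W lexx.
(* Uniqueness up to [t0] gives [V t0 = xm], so both solutions restart from the same state. *)
have xpE : beverton_holt beta (V t0) = xp.
  rewrite logistic_impulse_unique_before ?(ltW t0_gt0)// solution_before//.
  by rewrite subr0.
have [_ iV] := (integrable_logistic_impulse V).1 V_int.
have iW s : s <= T -> leb.-integrable `]t0, s[ (EFin \o (f \o W)).
  move=> sT; have iVs : leb.-integrable `]t0, s[ (EFin \o (f \o V)).
    apply: integrableS iV => // x /=; rewrite !in_itv/= => /andP[->/= xs].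
    exact: lt_le_trans sT.
  apply: eq_integrable iVs => // x; rewrite inE/= in_itv/= => /andP[tx _].
  by rewrite /= WE.
have [|||cW dW] := @integral_solution_C1 R f W t0 T t0_ltT.
- exact: continuous_logistic_rhs.
- exact: iW.
- move=> s; rewrite in_itv/= le_eqVlt Wt0 => /andP[/predU1P[<- _|ts sT]].
    by rewrite Wt0 set_itv_ge ?bnd_simp// Rintegral_set0 addr0.
  rewrite WE// V_after// xpE -Rintegral_itv_obnd_cbnd; last exact: iW.
  congr +%R; apply: eq_Rintegral => x; rewrite inE/= in_itv/= => /andP[tx _].
  by rewrite WE.
rewrite -WE//.
apply: (@one_sided_lipschitz_unique _ f r t0 T W
  (fun s => logistic_flow r K (s - t0) xp) cW _ dW).
- exact: continuous_logistic_flow post_impulse_ge0.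
- move=> s; rewrite in_itv/= => /andP[/ltW s0 _].
  exact: is_derive_logistic_flow_shift post_impulse_ge0 _.
- move=> s; rewrite in_itv/= => /andP[ts /ltW sT].
  apply: logistic_rhs_one_sided_lipschitz => //.
    by rewrite WE// V_ge0// (le_trans _ (ltW ts))// ltW.
  by rewrite logistic_flow_ge0 ?post_impulse_ge0// subr_ge0 ltW.
- by rewrite subrr logistic_flow0.
- by rewrite in_itv/= (ltW t0t).
Qed.

End Uniqueness.
End Solution.
End ImpulsiveLogistic.

Theorem theorem8p1 (R : realType) (r K alpha beta T t0 : R)
    (r_gt0 : 0 < r) (K_gt0 : 0 < K) (alpha_gt0 : 0 < alpha)
    (beta_gt0 : 0 < beta) (T_gt0 : 0 < T) (t0_itv : 0 < t0 < T)
    (u0 : R) (u0_ge0 : 0 <= u0) :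
  let g := derivator t0 alpha in
  let mu := stieltjes_measure t0 (ltW alpha_gt0) in
  let F := logistic_impulse_rhs r K alpha beta t0 in
  let U := logistic_impulse_solution r K beta t0 u0 in
  let xm := pre_impulse r K t0 u0 in
  let xp := post_impulse r K beta t0 u0 in
  [/\ nonneg_solution g mu T F u0 U,
      forall V : R -> R, nonneg_solution g mu T F u0 V ->
        forall t, 0 <= t <= T -> V t = U t &
      u0 <= K ->
        (forall t, 0 <= t <= T -> 0 <= U t <= K) /\
        [/\ 0 <= xp, xp <= xm & xm <= K]].
Proof.
have /andP[t0_gt0 t0_ltT] := t0_itv.
move=> g mu F U xm xp; split.
- exact: nonneg_solution_logistic_impulse.
- move=> V V_sol t /andP[t_ge0 tT]; have [tt0|t0t] := leP t t0.
    exact: logistic_impulse_unique_before V_sol _ t_ge0 tt0.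
  exact: logistic_impulse_unique_after V_sol _ t0t tT.
move=> u0K; split.
  move=> t /andP[t_ge0 _]; apply/andP; split; first exact: solution_ge0.
  exact: solution_leK.
split; first exact: post_impulse_ge0.
  by apply: beverton_holt_le; [exact: ltW|exact: pre_impulse_ge0].
by apply: logistic_flow_leK => //; exact: ltW.
Qed.
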